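(* Let $r>0$ and let $S\subset\mathbb{R}^d$ be a compact set with $\mathrm{reach}(S)\geq r$. Then $S$ is $r$-convex.
   Context: $\|\cdot\|$ is the Euclidean norm on $\mathbb{R}^d$, and $\mathring{B}(x,r)$ is the open ball with centre $x$ and radius $r$. Reach: let $\mathrm{Unp}(S)$ be the set of points $x\in\mathbb{R}^d$ having a unique projection (unique nearest point) on $S$. For $x\in S$ let $\mathrm{reach}(S,x)=\sup\{\rho>0:\ \mathring{B}(x,\rho)\subset\mathrm{Unp}(S)\}$, and let $\mathrm{reach}(S)=\inf\{\mathrm{reach}(S,x):\ x\in S\}$ (possibly $+\infty$). $r$-convexity: a set $S\subset\mathbb{R}^d$ is $r$-convex if $S=C_r(S)$, where $C_r(S)=\bigcap_{\{y:\ \mathring{B}(y,r)\cap S=\emptyset\}}\mathring{B}(y,r)^c$. Equivalently, for every $x\in S^c$ there exists $y\in\mathring{B}(x,r)$ with $\mathring{B}(y,r)\cap S=\emptyset$. *)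

(* Defs.v *)
From HB Require Import structures.
From mathcomp Require Import all_boot all_order all_algebra.
From mathcomp Require Import all_classical all_reals all_analysis.
Set Implicit Arguments. Unset Strict Implicit. Unset Printing Implicit Defensive.
Import Order.TTheory GRing.Theory Num.Theory.
Import numFieldNormedType.Exports.
Local Open Scope classical_set_scope.
Local Open Scope ring_scope.

(* R^d is 'rV[R]_d.  The library's norm `|x| and ball on 'rV[R]_d are those of
   the sup norm, so the Euclidean ones are defined here; the topology (hence
   [compact]) is the usual one, common to both norms. *)
Definition enorm (R : realType) (d : nat) (x : 'rV[R]_d) : R :=
  Num.sqrt (\sum_(i < d) x ord0 i ^+ 2).

Definition eball (R : realType) (d : nat) (x : 'rV[R]_d) (r : R)
  : set 'rV[R]_d := [set y | enorm (y - x) < r].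

Definition is_proj (R : realType) (d : nat) (S : set 'rV[R]_d)
  (x p : 'rV[R]_d) : Prop :=
  S p /\ forall q, S q -> enorm (x - p) <= enorm (x - q).

Definition Unp (R : realType) (d : nat) (S : set 'rV[R]_d) : set 'rV[R]_d :=
  [set x | exists! p, is_proj S x p].

(* The supremum is taken in \bar R; when no rho qualifies its value is -oo
   rather than the customary 0, which is immaterial when the reach is compared
   with a positive number. *)
Definition reach_at (R : realType) (d : nat) (S : set 'rV[R]_d)
  (x : 'rV[R]_d) : \bar R :=
  ereal_sup [set rho%:E | rho in [set rho : R | 0 < rho /\ eball x rho `<=` Unp S]].

(* Equal to +oo when S is empty. *)
Definition reach (R : realType) (d : nat) (S : set 'rV[R]_d) : \bar R :=
  ereal_inf [set reach_at S x | x in S].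

Definition r_hull (R : realType) (d : nat) (r : R) (S : set 'rV[R]_d)
  : set 'rV[R]_d :=
  \bigcap_(y in [set y | eball y r `&` S = set0]) ~` eball y r.

Definition r_convex (R : realType) (d : nat) (r : R) (S : set 'rV[R]_d)
  : Prop := S = r_hull r S.

(* Main.v *)
Require Import Defs.
From mathcomp Require Import all_boot all_order all_algebra.
From mathcomp Require Import all_classical all_reals all_analysis.
From mathcomp Require Import ring lra.
Set Implicit Arguments.
Unset Strict Implicit.
Unset Printing Implicit Defensive.
Import Order.TTheory GRing.Theory Num.Theory.
Import numFieldNormedType.Exports.
Local Open Scope classical_set_scope.
Local Open Scope ring_scope.

(** Let [f = edist S] be the distance to [S].  A point outside [S] must be shown
to lie within distance less than [r] of some [y] with [f y >= r], for then the
open ball of radius [r] about [y] misses [S].  The only case with content is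
[0 < f x < r].

The bound on the reach says that every point with [f y < r] has a unique
projection [p].  At such a point, if [f y > 0], the distance grows at rate 1
when one moves away from [p]: with [v = (y - p) / f y] and any [0 <= c < 1],
[f (y + h v) > f y + c h] for all small [h > 0] ([edist_increase]).  In other
words [f] has no local obstacle to increasing with slope [c] as long as it has
not reached the value [r].

This local growth is made global by a maximum principle ([exists_far_point]),
which takes the place of integrating the gradient flow of [f].  For [c < 1]
maximise [f y - c |y - x|] over the closed ball of radius [(r - f x) / c] about
[x].  A maximiser [y] satisfies [f y >= f x + c |y - x|].  If [y] were interior
with [f y < r], a small step along [v] would beat it; and on the boundary sphere
the inequality already gives [f y >= r].  Hence [f y >= r] in all cases, and
[|y - x| <= (r - f x) / c], which is less than [r] as soon as [c] is close
enough to 1. *)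

(** * The Euclidean inner product and norm *)

Definition dot (R : realType) (d : nat) (u v : 'rV[R]_d) : R :=
  \sum_(i < d) u ord0 i * v ord0 i.

Section EuclideanNorm.
Context {R : realType} {d : nat}.
Implicit Types (u v w x y : 'rV[R]_d) (a h : R).

Lemma dotC u v : dot u v = dot v u.
Proof. by apply: eq_bigr => i _; rewrite mulrC. Qed.

Lemma dotDl u v w : dot (u + v) w = dot u w + dot v w.
Proof. by rewrite -big_split; apply: eq_bigr => i _; rewrite mxE mulrDl. Qed.

Lemma dotZl a u v : dot (a *: u) v = a * dot u v.
Proof. by rewrite /dot mulr_sumr; apply: eq_bigr => i _; rewrite mxE mulrA. Qed.

Lemma dotDr u v w : dot u (v + w) = dot u v + dot u w.
Proof. by rewrite !(dotC u) dotDl. Qed.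

Lemma dotZr a u v : dot u (a *: v) = a * dot u v.
Proof. by rewrite !(dotC u) dotZl. Qed.

Lemma dotNl u v : dot (- u) v = - dot u v.
Proof. by rewrite -scaleN1r dotZl mulN1r. Qed.

Lemma enormE u : enorm u = Num.sqrt (dot u u).
Proof. by congr Num.sqrt; apply: eq_bigr => i _; rewrite expr2. Qed.

Lemma enorm_ge0 u : 0 <= enorm u.
Proof. exact: sqrtr_ge0. Qed.

Lemma enorm_sqr u : enorm u ^+ 2 = dot u u.
Proof.
rewrite enormE sqr_sqrtr //; apply: sumr_ge0 => i _.
by rewrite -expr2 sqr_ge0.
Qed.

Lemma enorm0 : enorm (0 : 'rV[R]_d) = 0.
Proof.
by rewrite enormE /dot big1 ?sqrtr0// => i _; rewrite mxE mul0r.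
Qed.

Lemma coord_le_enorm u i : `|u ord0 i| <= enorm u.
Proof.
rewrite -sqrtr_sqr ler_wsqrtr // (bigD1 i) //= lerDl.
by apply: sumr_ge0 => j _; exact: sqr_ge0.
Qed.

Lemma enorm_eq0 u : enorm u = 0 -> u = 0.
Proof.
move=> u0; apply/rowP => i; rewrite mxE; apply/eqP.
by rewrite -normr_le0 -u0 coord_le_enorm.
Qed.

Lemma enormN u : enorm (- u) = enorm u.
Proof. by rewrite !enormE dotNl dotC dotNl opprK. Qed.

Lemma enormB x y : enorm (x - y) = enorm (y - x).
Proof. by rewrite -enormN opprB. Qed.

Lemma enormZ a u : 0 <= a -> enorm (a *: u) = a * enorm u.
Proof.
move=> a0; rewrite !enormE dotZl dotZr mulrA -expr2 sqrtrM ?sqr_ge0//.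
by rewrite sqrtr_sqr ger0_norm.
Qed.

Lemma enorm_sqrD u v :
  enorm (u + v) ^+ 2 = enorm u ^+ 2 + 2 * dot u v + enorm v ^+ 2.
Proof. by rewrite !enorm_sqr dotDl !dotDr (dotC v u); ring. Qed.

(** Cauchy-Schwarz: expand the nonnegative square [||v| u - |u| v|^2]. *)
Lemma dot_le_enorm u v : dot u v <= enorm u * enorm v.
Proof.
have [/enorm_eq0 ->|u0] := eqVneq (enorm u) 0.
  by rewrite -(scale0r 0) dotZl mul0r mulr_ge0 ?enorm_ge0.
have [/enorm_eq0 ->|v0] := eqVneq (enorm v) 0.
  by rewrite -(scale0r 0) dotZr mul0r mulr_ge0 ?enorm_ge0.
have uv0 : 0 < enorm u * enorm v by rewrite mulr_gt0 // lt_def enorm_ge0 ?u0 ?v0.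
have := sqr_ge0 (enorm (enorm v *: u + - (enorm u *: v))).
rewrite enorm_sqrD enormN !enormZ ?enorm_ge0// dotC dotNl !dotZl dotZr.
rewrite (dotC v u) => H.
rewrite -(ler_pM2l uv0); nra.
Qed.

Lemma enormD u v : enorm (u + v) <= enorm u + enorm v.
Proof.
rewrite -(@ler_pXn2r _ 2) ?nnegrE ?addr_ge0 ?enorm_ge0// enorm_sqrD.
by have := dot_le_enorm u v; nra.
Qed.

Lemma enorm_triangle x y z : enorm (x - z) <= enorm (x - y) + enorm (y - z).
Proof. by rewrite (le_trans _ (enormD _ _))// addrA subrK. Qed.


(** * Topology of the Euclidean norm *)

Lemma continuous_dot (T : topologicalType) (f g : T -> 'rV[R]_d) :
  continuous f -> continuous g -> continuous (fun t => dot (f t) (g t)).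
Proof.
move=> fc gc; apply: continuous_big => [|i _]; first exact: add_continuous.
move=> t; apply: cvgM.
  exact: (continuous_comp (fc t) (@coord_continuous _ _ _ ord0 i _)).
exact: (continuous_comp (gc t) (@coord_continuous _ _ _ ord0 i _)).
Qed.

Lemma continuous_enorm : continuous (@enorm R d).
Proof.
move=> x; apply: (@continuous_comp _ _ _ (fun u => \sum_(i < d) u ord0 i ^+ 2));
  last exact: sqrt_continuous.
by apply: (continuous_dot (f := id) (g := id)) => t; exact: cvg_id.
Qed.

Lemma continuous_enormB x : continuous (fun y => enorm (y - x)).
Proof.
move=> y; apply: (@continuous_comp _ _ _ (fun y => y - x));
  last exact: continuous_enorm.
by apply: (cvgB (FF := nbhs_filter y)); [exact: cvg_id|exact: cvg_cst].
Qed.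

(** A closed Euclidean ball is a closed part of a product of segments, which is
compact by Tychonoff. *)
Lemma compact_closed_eball x (rho : R) :
  compact [set y | enorm (y - x) <= rho].
Proof.
apply: (@subclosed_compact _ _
  [set y : 'rV[R]_d | forall i,
    `[x ord0 i - rho, x ord0 i + rho]%classic (y ord0 i)]).
- exact: (preimage_closed (fun y _ => @continuous_enormB x y) (@closed_le R rho)).
- apply: (@rV_compact _ _ (fun i => `[x ord0 i - rho, x ord0 i + rho]%classic)).
  by move=> i; exact: segment_compact.
move=> y /= yx i; have := le_trans (coord_le_enorm (y - x) i) yx.
by rewrite !mxE in_itv/= ler_distl.
Qed.

End EuclideanNorm.

(** * The distance to a compact set *)

Definition edist (R : realType) (d : nat) (S : set 'rV[R]_d) (x : 'rV[R]_d) : R :=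
  inf [set enorm (x - q) | q in S].

Section Distance.
Context {R : realType} {d : nat}.
Implicit Types (S : set 'rV[R]_d) (x y p q : 'rV[R]_d).

Lemma exists_proj S x : compact S -> S !=set0 -> exists p, is_proj S x p.
Proof.
move=> cS S0.
have [|p pS pmin] := compact_EVT_min S0 cS
    (f := fun q => enorm (q - x)).
  exact/continuous_subspaceT/continuous_enormB.
exists p; split; first exact: set_mem.
by move=> q /mem_set/pmin; rewrite enormB (enormB q).
Qed.

Lemma edistE S x p : is_proj S x p -> edist S x = enorm (x - p).
Proof.
move=> [Sp pmin]; apply/eqP; rewrite eq_le; apply/andP; split.
  apply: ge_inf; last by exists p.
  by exists 0 => _ [q _ <-]; exact: enorm_ge0.
by apply: lb_le_inf; [exists (enorm (x - p)), p|move=> _ [q Sq <-]; exact: pmin].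
Qed.

Lemma edist_le S x q : S q -> edist S x <= enorm (x - q).
Proof.
by move=> Sq; apply: ge_inf; [exists 0 => _ [? _ <-]; exact: enorm_ge0|exists q].
Qed.

Lemma edist_lipschitz S x y : compact S -> S !=set0 ->
  edist S x <= edist S y + enorm (x - y).
Proof.
move=> cS S0; have [p yp] := exists_proj y cS S0.
rewrite (edistE yp) addrC (le_trans (edist_le x yp.1))//.
exact: enorm_triangle.
Qed.

Lemma continuous_edist S : compact S -> S !=set0 -> continuous (edist S).
Proof.
move=> cS S0 x; apply/(cvgrPdist_le (FF := nbhs_filter x)) => e e0.
have /(cvgrPdist_le (FF := nbhs_filter x))/(_ e e0) := @continuous_enormB R d x x.
apply: filterS => y; rewrite subrr enorm0 sub0r normrN ger0_norm ?enorm_ge0//.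
move=> yx; rewrite ler_distl.
have := edist_lipschitz x y cS S0; have := edist_lipschitz y x cS S0.
by rewrite (enormB x y); lra.
Qed.

(** * Growth of the distance up to the value allowed by the reach *)

(** Directional growth of the distance at a point with a unique projection [p],
obtained without continuity of the projection.  The direction [v] points from
[p] to [y].  Points [q] of [S] with [dot (y - q) v > c f(y)] recede fast enough
by the expansion of [|y + h v - q|^2].  The other points of [S] form a compact
set [A] that avoids [p]; uniqueness of [p] makes [A] stay farther from [y] than
[p] by a positive margin, which a short step cannot use up. *)
Lemma edist_increase S y c : compact S -> S !=set0 -> Unp S y ->
  0 < edist S y -> 0 <= c < 1 ->
  exists2 v, enorm v = 1 & exists2 h0, 0 < h0 &
    forall h, 0 < h <= h0 -> edist S y + c * h < edist S (y + h *: v).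
Proof.
move=> cS S0 [p [yp puniq]]; set dl := edist S y => dl0 /andP[c0 c1].
have dlE : enorm (y - p) = dl by rewrite /dl (edistE yp).
pose v := dl^-1 *: (y - p).
have v1 : enorm v = 1 by rewrite enormZ ?invr_ge0 1?ltW// dlE mulVf ?gt_eqF.
have pv : dot (y - p) v = dl.
  by rewrite dotZr -enorm_sqr dlE expr2 mulKf ?gt_eqF.
pose A := S `&` [set q | dot (y - q) v <= c * dl].
have cA : compact A.
  apply: compact_closedI => //.
  apply: (preimage_closed (f := fun q => dot (y - q) v) _ (@closed_le R (c * dl))).
  move=> q _; apply: (continuous_dot (f := fun q => y - q) (g := cst v)) => t.
    by apply: (cvgB (FF := nbhs_filter t)); [exact: cvg_cst|exact: cvg_id].
  exact: cst_continuous.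
(* The margin is halved because a step of length [h] may bring [A] closer by
   [h] while the distance to beat grows by less than [h]. *)
have [e e0 Ae] : exists2 e, 0 < e & forall q, A q -> dl + 2 * e <= enorm (y - q).
  have [->|A0] := eqVneq A set0; first by exists 1.
  move/set0P : A0 => A0.
  have [m [[Sm /= mv] mmin]] := exists_proj y cA A0.
  suff dlm : dl < enorm (y - m).
    exists ((enorm (y - m) - dl) / 2); first lra.
    by move=> q /mmin; lra.
  rewrite ltNge; apply/negP => mdl.
  have /puniq pm : is_proj S y m.
    by split => // q Sq; rewrite (le_trans mdl)// edist_le.
  by move: mv; rewrite -pm pv; nra.
exists v => //; exists e => // h /andP[h0 he].
have [q yhq] := exists_proj (y + h *: v) cS S0.
have Sq : S q by case: yhq.
rewrite (edistE yhq).
have yq : dl <= enorm (y - q) by exact: edist_le.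
have [Aq|qv] := leP (dot (y - q) v) (c * dl).
  have /Ae qe : A q by [].
  have := enorm_triangle y (y + h *: v) q.
  by rewrite opprD addNKr enormN enormZ ?(ltW h0)// v1; nra.
rewrite -(@ltr_pXn2r _ 2) ?nnegrE ?enorm_ge0//; last nra.
rewrite addrAC enorm_sqrD enormZ ?(ltW h0)// v1 dotZr.
have ? : h * (c * dl) < h * dot (y - q) v by rewrite ltr_pM2l.
have ? : dl ^+ 2 <= enorm (y - q) ^+ 2 by nra.
have ch0 : 0 <= c * h by nra.
have chh : c * h <= h by nra.
have ? : (c * h) ^+ 2 <= h ^+ 2 by nra.
lra.
Qed.

(** The maximum principle.  The set [K] below is the ball of radius [rho] on which
[edist S y - c |y - x|] is maximised; its radius is chosen so that growth of
slope [c] from [x] to its boundary brings the distance exactly up to [r]. *)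
Lemma exists_far_point S x (r : R) : compact S -> S !=set0 ->
  (forall y, edist S y < r -> Unp S y) -> 0 < edist S x < r ->
  exists2 y, enorm (y - x) < r & r <= edist S y.
Proof.
move=> cS S0 Sr /andP[]; set dl := edist S x => dl0 dlr.
have r0 : 0 < r by lra.
(* Any slope [c] with [1 - dl / r < c < 1] would do: the lower bound is what
   makes the radius [rho = (r - dl) / c] smaller than [r]. *)
pose c := 1 - dl / (2 * r).
have cr : c * r = r - dl / 2 by rewrite /c; field; rewrite gt_eqF.
have c0 : 0 < c by nra.
have c1 : c < 1 by nra.
pose rho := (r - dl) / c.
have rhoc : c * rho = r - dl by rewrite /rho; field; rewrite gt_eqF.
have rho0 : 0 < rho by nra.
have rhor : rho < r by nra.
pose K : set 'rV[R]_d := [set y | enorm (y - x) <= rho].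
have Kx : K x by rewrite /K/= subrr enorm0 ltW.
have K0 : K !=set0 by exists x.
have [|y /set_mem Ky ymax] := compact_EVT_max K0 (@compact_closed_eball _ _ x rho)
    (f := fun y => edist S y - c * enorm (y - x)).
  apply: continuous_subspaceT => y; apply: (cvgB (FF := nbhs_filter y)).
    exact: (continuous_edist cS S0).
  apply: (cvgM (FF := nbhs_filter y)); first exact: cst_continuous.
  exact: continuous_enormB.
have {}Ky : enorm (y - x) <= rho by [].
have := ymax x (mem_set Kx); rewrite subrr enorm0 mulr0 subr0 -/dl => yx.
exists y; first exact: le_lt_trans rhor.
rewrite leNgt; apply/negP => yr.
have yx0 := enorm_ge0 (y - x).
(* On the sphere of radius [rho] the inequality [yx] would give [edist S y >= r],
   since [c * rho = r - dl]; so there is room left for a step. *)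
have yrho : enorm (y - x) < rho by nra.
have y0 : 0 < edist S y by nra.
have c01 : 0 <= c < 1 by rewrite (ltW c0).
have [v v1 [h0 h00 yv]] := edist_increase cS S0 (Sr _ yr) y0 c01.
pose h := Num.min h0 (rho - enorm (y - x)).
have hgt0 : 0 < h by rewrite lt_min h00 subr_gt0.
have hh0 : h <= h0 by rewrite ge_min lexx.
have hrho : h <= rho - enorm (y - x) by rewrite ge_min lexx orbT.
have yhx : enorm (y + h *: v - x) <= enorm (y - x) + h.
  by rewrite addrAC (le_trans (enormD _ _))// enormZ ?(ltW hgt0)// v1 mulr1.
have Kyh : K (y + h *: v) by rewrite /K/=; lra.
have /yv : 0 < h <= h0 by rewrite hgt0.
by have := ymax _ (mem_set Kyh); nra.
Qed.

(** Apply the definition of reach at a projection [p] of [y], since [y] lies in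
the ball of radius less than [r] about [p]. *)
Lemma reach_Unp S (r : R) y : compact S -> S !=set0 -> (r%:E <= reach S)%E ->
  edist S y < r -> Unp S y.
Proof.
move=> cS S0 rS yr; have [p yp] := exists_proj y cS S0.
have rp : (r%:E <= reach_at S p)%E.
  by apply: (le_trans rS); apply: ereal_inf_lbound; exists p => //; case: yp.
have /ereal_sup_gt[_ [rho [_ Brho] <-]] : ((edist S y)%:E < reach_at S p)%E.
  by apply: lt_le_trans rp; rewrite lte_fin.
by rewrite lte_fin (edistE yp) => /Brho.
Qed.

End Distance.

Theorem proposition1 (R : realType) (d : nat) (r : R) (S : set 'rV[R]_d) :
  0 < r -> compact S -> (r%:E <= reach S)%E -> r_convex r S.
Proof.
move=> r0 cS rS; apply/seteqP; split => [x Sx y /= yS xy|x xhull].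
  by have : set0 x by rewrite -yS.
apply: contrapT => nSx.
suff [y xy yS] : exists2 y, enorm (y - x) < r & forall q, S q -> r <= enorm (y - q).
  apply: (xhull y) => /=; last by rewrite /eball/= enormB.
  rewrite -subset0 => q [/= qy /yS].
  by rewrite enormB leNgt qy.
have [S0|/set0P S0] := eqVneq S set0.
  by exists x; [rewrite subrr enorm0|rewrite S0].
have [xr|rx] := ltP (edist S x) r; last first.
  exists x; first by rewrite subrr enorm0.
  by move=> q /(edist_le x); exact: le_trans.
have dx0 : 0 < edist S x.
  have [p xp] := exists_proj x cS S0.
  rewrite (edistE xp) lt_def enorm_ge0 andbT; apply/eqP => /enorm_eq0/eqP.
  by rewrite subr_eq0 => /eqP xp0; apply: nSx; rewrite xp0; case: xp.
have [||y xy ry] := @exists_far_point _ _ S x r cS S0.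
- by move=> y; exact: reach_Unp.
- by rewrite dx0.
by exists y => // q /(edist_le y); exact: le_trans.
Qed.
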